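(* Suppose $m=n$. Let $\mu=\mathcal{N}(m_0,\Sigma_0)$ and $\nu=\mathcal{N}(m_1,\Sigma_1)$ be two Gaussian measures on $\mathbb{R}^m=\mathbb{R}^n$. Let $\Sigma_0=P_0D_0P_0^T$ and $\Sigma_1=P_1D_1P_1^T$ be diagonalizations ($P_0,P_1$ orthogonal, $D_0,D_1$ diagonal) which sort the eigenvalues in non-increasing order. Suppose that $\Sigma_0$ is non-singular and that there exists a scalar $\lambda\ge0$ such that $D_1=\lambda D_0$. Then $GW_2^2(\mu,\nu)=GGW_2^2(\mu,\nu)=LGW_2^2(\mu,\nu)$, and the problem defining $GW_2^2(\mu,\nu)$ admits a solution of the form $(I_m,T)\#\mu$ with $T$ affine of the form $$\forall x\in\mathbb{R}^m,\quad T(x)=m_1+\sqrt{\lambda}\,P_1\tilde I_mP_0^T(x-m_0),$$ where $\tilde I_m$ is any matrix of the form $\mathrm{diag}((\pm1)_{i\le m})$. Moreover $$GW_2^2(\mu,\nu)=(\lambda-1)^2\left(4(\mathrm{tr}(\Sigma_0))^2+8\|\Sigma_0\|_{\mathcal{F}}^2\right).$$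
   Context: For probability measures $\mu$ on $\mathbb{R}^m$, $\nu$ on $\mathbb{R}^n$, let $\Pi(\mu,\nu)$ be the set of probability measures on $\mathbb{R}^m\times\mathbb{R}^n$ with marginals $\mu,\nu$, and for $\pi\in\Pi(\mu,\nu)$ let $$J(\pi)=\int\int\left(\|x-x'\|_{\mathbb{R}^m}^2-\|y-y'\|_{\mathbb{R}^n}^2\right)^2d\pi(x,y)\,d\pi(x',y').$$ Then $GW_2^2(\mu,\nu)=\inf_{\pi\in\Pi(\mu,\nu)}J(\pi)$ and $GGW_2^2(\mu,\nu)=\inf_{\pi\in\Pi(\mu,\nu)\cap\mathcal{N}_{m+n}}J(\pi)$, where $\mathcal{N}_{m+n}$ is the set of (possibly degenerate) Gaussian measures on $\mathbb{R}^{m+n}$. For $n\le m$, and with $D_0,D_1$ the diagonal matrices of eigenvalues of $\Sigma_0,\Sigma_1$ in non-increasing order, $$LGW_2^2(\mu,\nu)=4\left(\mathrm{tr}(D_0)-\mathrm{tr}(D_1)\right)^2+4\left(\|D_0\|_{\mathcal{F}}-\|D_1\|_{\mathcal{F}}\right)^2+4\|D_0^{(n)}-D_1\|_{\mathcal{F}}^2+4\left(\|D_0\|_{\mathcal{F}}^2-\|D_0^{(n)}\|_{\mathcal{F}}^2\right),$$ where $\|\cdot\|_{\mathcal{F}}$ is the Frobenius norm and $D_0^{(n)}$ is the submatrix of the first $n$ rows and $n$ columns of $D_0$ (so $D_0^{(n)}=D_0$ when $m=n$). $(I_m,T)\#\mu$ is the push-forward of $\mu$ by $x\mapsto(x,T(x))$.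 *)

(* Defs.v *)
From HB Require Import structures.
From mathcomp Require Import all_boot all_order all_algebra.
From mathcomp Require Import all_classical all_reals all_analysis.

Set Implicit Arguments.
Unset Strict Implicit.
Unset Printing Implicit Defensive.

Import Order.TTheory GRing.Theory Num.Theory.
Import numFieldNormedType.Exports.

Local Open Scope classical_set_scope.
Local Open Scope ring_scope.

(* R^n, as column vectors, with its Borel sigma-algebra; it is convertible to
   'cV[R]_n. *)
Notation borel_cV R n := (g_sigma_algebraType (@open 'cV[R]_n)).

Section matrices.
Context {R : realType}.

Definition frobenius m n (A : 'M[R]_(m, n)) : R :=
  Num.sqrt (\sum_i \sum_j A i j ^+ 2).

Definition dotcV n (u x : 'cV[R]_n) : R := (u^T *m x) 0 0.

(* The norm `|_| that the library puts on matrices is the max-norm. *)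
Definition enorm n (x : 'cV[R]_n) : R := Num.sqrt (dotcV x x).

Definition orthogonal_mx n (P : 'M[R]_n) : Prop := P *m P^T = 1%:M.

Definition noninc_diag n (D : 'M[R]_n) : Prop :=
  is_diag_mx D /\ forall i j : 'I_n, (i <= j)%N -> D j j <= D i i.

Definition sorted_diagonalization n (S P D : 'M[R]_n) : Prop :=
  [/\ orthogonal_mx P, noninc_diag D & S = P *m D *m P^T].

Definition covariance_mx n (S : 'M[R]_n) : Prop :=
  S^T = S /\ forall u : 'cV[R]_n, 0 <= dotcV u (S *m u).

Definition leading_submx m n (le_nm : (n <= m)%N) (D : 'M[R]_m) : 'M[R]_n :=
  mxsub (widen_ord le_nm) (widen_ord le_nm) D.

End matrices.

Section gaussian.
Context {R : realType}.

(* The law N(m, v) on the line, v being the variance. The degenerate case is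
   separate because [normal_prob m 0] is the uniform law on [0, 1]. *)
Definition normal_law (m v : R) : set R -> \bar R :=
  if v == 0 then \d_m else normal_prob m (Num.sqrt v).

(* P is the possibly degenerate Gaussian N(m, S) on R^n: every linear form
   <u, _> has law N(<u, m>, <u, S u>) under P. *)
Definition gaussian_with n (m : 'cV[R]_n) (S : 'M[R]_n)
    (P : set (borel_cV R n) -> \bar R) : Prop :=
  covariance_mx S /\
  forall (u : 'cV[R]_n) (A : set R), measurable A ->
    pushforward P (dotcV u : borel_cV R n -> R) A =
    normal_law (dotcV u m) (dotcV u (S *m u)) A.

Definition gaussian n (P : set (borel_cV R n) -> \bar R) : Prop :=
  exists m S, gaussian_with m S P.

End gaussian.

Section gromov_wasserstein.
Context {R : realType} {m n : nat}.
Implicit Types (mu : probability (borel_cV R m) R)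
  (nu : probability (borel_cV R n) R)
  (pi : probability (borel_cV R m * borel_cV R n)%type R).

Definition coupling mu nu pi : Prop :=
  (forall A, measurable A -> pushforward pi fst A = mu A) /\
  (forall B, measurable B -> pushforward pi snd B = nu B).

(* Gaussian on R^m x R^n, through the identification with R^(m + n) *)
Definition gaussian_pair pi : Prop :=
  gaussian (pushforward pi
    (fun p => col_mx p.1 p.2 : borel_cV R (m + n))).

Definition gw_cost pi : \bar R :=
  (\int[pi]_p \int[pi]_q
     ((enorm (p.1 - q.1 : 'cV[R]_m) ^+ 2
       - enorm (p.2 - q.2 : 'cV[R]_n) ^+ 2) ^+ 2)%:E)%E.

Definition GW2sq mu nu : \bar R :=
  ereal_inf [set gw_cost pi | pi in [set pi | coupling mu nu pi]].

Definition GGW2sq mu nu : \bar R :=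
  ereal_inf [set gw_cost pi
            | pi in [set pi | coupling mu nu pi /\ gaussian_pair pi]].

Definition GW_solution mu nu pi : Prop :=
  coupling mu nu pi /\ gw_cost pi = GW2sq mu nu.

(* LGW_2^2 of two measures, in terms of the matrices D0 and D1 of the
   eigenvalues of their covariances sorted in non-increasing order. *)
Definition LGW2sq (le_nm : (n <= m)%N) (D0 : 'M[R]_m) (D1 : 'M[R]_n) : R :=
  let D0n := leading_submx le_nm D0 in
  4 * (\tr D0 - \tr D1) ^+ 2
  + 4 * (frobenius D0 - frobenius D1) ^+ 2
  + 4 * frobenius (D0n - D1) ^+ 2
  + 4 * (frobenius D0 ^+ 2 - frobenius D0n ^+ 2).

End gromov_wasserstein.

(* Main.v *)
Require Import Defs.
From HB Require Import structures.
From mathcomp Require Import all_boot all_order all_algebra.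
From mathcomp Require Import all_classical all_reals all_analysis.
From mathcomp Require Import measurable_realfun ring lra.

Set Implicit Arguments.
Unset Strict Implicit.
Unset Printing Implicit Defensive.

Import Order.TTheory GRing.Theory Num.Theory.
Import numFieldNormedType.Exports.

Local Open Scope classical_set_scope.
Local Open Scope ring_scope.

(** The distances ||x - x'|| between two independent points of mu and of nu
    determine everything. Let X = ||x - x'||^2 and Y = ||y - y'||^2 be seen as
    functions on the square of a coupling pi, so that the cost of pi is the
    squared L^2 distance between X and Y. The norms of X and Y depend on the
    marginals only, and when D1 = lambda D0 they satisfy |Y| = lambda |X|. Hence
    |X - Y| >= | |X| - |Y| | = |lambda - 1| |X| whatever the coupling
    ([gw_cost_ge]). Conversely, an affine map T whose linear part is sqrt lambda
    times an isometry gives Y = lambda X on the nose, hence equality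
    ([affine_coupling_cost]). Since this coupling is Gaussian, the two infima
    agree, and the value (lambda - 1)^2 |X|^2 is LGW rewritten.

    Two facts about Gaussian measures known only by their one-dimensional
    projections are needed.

    - The norm of X: the mean of ||x - x'||^4 is 4 (tr S)^2 + 8 ||S||_F^2
      ([gaussian_quartic_spread]). The products (x - x')_i^2 (x - x')_j^2 are
      combinations of fourth powers of linear forms, by polarization, and a
      linear form of x - x' has the fourth moment of N(0, 2 u^T S u), so the
      second and fourth moments of the normal law on the line suffice.

    - The image of mu by T is nu: both have the same projections, and a
      probability on R^n is determined by its projections ([cramer_wold]). The
      integrals of the functions cos(<u, x> + c) are determined by the
      projections. These functions span an algebra, and the closure of this
      algebra under bounded pointwise limits contains the sign of each of its
      elements, hence the indicators of half-spaces, hence those of all Borel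
      sets. *)

(** * Borel sets of R^n and half-spaces *)

Section euclidean_borel.
Context {R : realType}.

Lemma dotcVE n (u x : 'cV[R]_n) : dotcV u x = \sum_i u i 0 * x i 0.
Proof. by rewrite /dotcV mxE; apply: eq_bigr => i _; rewrite mxE. Qed.

Lemma dotcV_delta n (i : 'I_n) (x : 'cV[R]_n) : dotcV (delta_mx i 0) x = x i 0.
Proof.
rewrite dotcVE (bigD1 i)//= !mxE !eqxx mul1r big1 ?addr0// => j ji.
by rewrite mxE (negbTE ji) mul0r.
Qed.

Definition half_spaces n : set (set 'cV[R]_n) :=
  [set E | exists u a, E = [set x | a < dotcV u x]].

(** An open set is the countable union of the boxes with rational centre and
    radius 1 / (k + 1) that it contains, and a box is a finite intersection of
    half-spaces. *)
Lemma measurable_open_half_spaces n (U : set 'cV[R]_n) :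
  open U -> <<s @half_spaces n >> U.
Proof.
move=> oU.
pose rad (p : 'cV[rat]_n * nat) : R := p.2.+1%:R^-1.
pose ctr (p : 'cV[rat]_n * nat) : 'cV[R]_n := map_mx ratr p.1.
pose box p : set 'cV[R]_n := [set x | forall i, ball (ctr p i 0) (rad p) (x i 0)].
have -> : U = \bigcup_(p in [set p | box p `<=` U]) box p.
  apply/seteqP; split=> [x Ux|x [p /= pU /pU]//].
  have /nbhs_ballP[e /= e0 eU] : nbhs x U by exact: open_nbhs_nbhs.
  have [k [d [dE d0 ke]]] : exists k (d : R), [/\ k.+1%:R^-1 = d, 0 < d & 2 * d < e].
    have e2 : 0 < e / 2 by rewrite divr_gt0.
    have /filter_ex[k /= ke] := near_infty_natSinv_lt (PosNum e2).
    by exists k, k.+1%:R^-1; split; rewrite ?invr_gt0// mulrC -ltr_pdivlMr.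
  have /(_ _)/cid q (i : 'I_n) : exists q : rat, x i 0 - d < ratr q < x i 0 + d.
    have [|q] := @rat_in_itvoo R (x i 0 - d) (x i 0 + d); first lra.
    by rewrite in_itv/= => qi; exists q.
  exists (\col_i sval (q i), k) => /=; last first.
    move=> i; rewrite /ctr/rad/= !mxE dE /ball/= ltr_distlC.
    by case: (q i) => /= r /andP[? ?]; apply/andP; split; lra.
  move=> y yq; apply: eU; split=> // i j; rewrite (ord1 j).
  move: (yq i); rewrite /ctr/rad/= !mxE dE /ball/= !ltr_distlC.
  by case: (q i) => /= r /andP[? ?] /andP[? ?]; apply/andP; split; lra.
rewrite -[<<s _ >> _]/(measurable (_ : set (g_sigma_algebraType (@half_spaces n)))).
have mbox p : measurable (box p : set (g_sigma_algebraType (@half_spaces n))).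
  have -> : box p = \bigcap_(i in [set: 'I_n])
      ([set x | ctr p i 0 - rad p < dotcV (delta_mx i 0) x] `&`
       [set x | - (ctr p i 0 + rad p) < dotcV (- delta_mx i 0) x]).
    have dN i x : dotcV (- delta_mx i 0) x = - (x i 0) :> R.
      by rewrite /dotcV linearN mulNmx mxE -/(dotcV _ _) dotcV_delta.
    apply/seteqP; split=> [x bx i _/=|x bx i].
      move: (bx i); rewrite /ball/= ltr_distlC dotcV_delta dN => /andP[? ?].
      by split; lra.
    move: (bx i I) => /=; rewrite dotcV_delta dN /ball/= ltr_distlC => -[? ?].
    by apply/andP; split; lra.
  apply: fin_bigcap_measurable; first exact: finite_finset.
  by move=> i _; apply: measurableI; apply: sub_sigma_algebra; do 2!eexists.
(* The pairs (centre, k) form a countable type: index the union by their codes. *)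
pose F p := if pselect (box p `<=` U) then box p else set0.
have -> : \bigcup_(p in [set p | box p `<=` U]) box p =
   \bigcup_(k in [set: nat]) (if unpickle k is Some p then F p else set0).
  apply/seteqP; split=> x.
    move=> [p /= pU px]; exists (pickle p) => //; rewrite pickleK /F.
    by case: pselect.
  move=> [k _]; case: unpickle => // p; rewrite /F; case: pselect => // pU px.
  by exists p.
apply: bigcup_measurable => k _; case: unpickle => // p; rewrite /F.
by case: pselect => _ /=; [exact: mbox|exact: measurable0].
Qed.

Lemma measurable_coord n (i : 'I_n) :
  measurable_fun [set: borel_cV R n] (fun x => x i 0 : R).
Proof.
apply: (measurability _ (RGenOInfty.measurableE R)).
move=> _ [_ [a ->] <-]; rewrite setTI; apply: sub_sigma_algebra.
apply: open_comp; last exact: interval_open.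
by move=> x _; exact: coord_continuous.
Qed.

Lemma measurable_dotcV n (u : 'cV[R]_n) :
  measurable_fun [set: borel_cV R n] (dotcV u : borel_cV R n -> R).
Proof.
rewrite (_ : dotcV u = fun x => \sum_i u i 0 * x i 0); last first.
  by apply/funext => x; rewrite dotcVE.
apply: measurable_sum => i; apply: measurable_funM => //.
exact: measurable_coord.
Qed.

Lemma measurable_borel_cVE n :
  (measurable : set (set (borel_cV R n))) = <<s @half_spaces n >>.
Proof.
apply/seteqP; split; apply: smallest_sub.
- exact: smallest_sigma_algebra.
- by move=> U; exact: measurable_open_half_spaces.
- exact: smallest_sigma_algebra.
- move=> _ [u [a ->]].
  rewrite (_ : [set x | _] = [set: borel_cV R n] `&` dotcV u @^-1` `]a, +oo[).
    by apply: measurable_dotcV => //; exact: measurable_itv.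
  by rewrite setTI; apply/seteqP; split=> x /=; rewrite in_itv/= andbT.
Qed.

Lemma measurable_fun_borel_cV d (T : measurableType d) n (f : T -> borel_cV R n) :
  (forall u, measurable_fun [set: T] (fun t => dotcV u (f t))) ->
  measurable_fun [set: T] f.
Proof.
move=> mf; apply: (measurability _ (measurable_borel_cVE n)).
move=> _ [_ [u [a ->]] <-].
rewrite (_ : f @^-1` _ = (fun t => dotcV u (f t)) @^-1` `]a, +oo[).
  by apply: mf => //; exact: measurable_itv.
by apply/seteqP; split=> x /=; rewrite in_itv/= andbT.
Qed.

End euclidean_borel.

(** * A measure is determined by its one-dimensional projections *)

Section cramer_wold.
Context {R : realType} {n : nat}.

(** Products are not a constructor: the integral of a product is not determined
    by the integrals of its factors. Stability under products is instead a
    theorem ([trigM]), inherited from the product formula for cosines. *)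
Inductive trig_closure : (borel_cV R n -> R) -> Prop :=
| trig_cos u c : trig_closure (fun x => cos (dotcV u x + c))
| trig_lin a f g : trig_closure f -> trig_closure g ->
    trig_closure (fun x => a * f x + g x)
| trig_lim (F : nat -> borel_cV R n -> R) f M :
    (forall k, trig_closure (F k)) -> (forall k x, `|F k x| <= M) ->
    (forall x, F k x @[k --> \oo] --> f x) -> trig_closure f.

Lemma trig_ext f g : trig_closure f -> f =1 g -> trig_closure g.
Proof. by move=> + /funext <-. Qed.

Lemma trig_cst a : trig_closure (fun=> a).
Proof.
have c1 : trig_closure (fun=> 1).
  apply: trig_ext (trig_cos 0 0) _ => x.
  by rewrite dotcVE big1 ?addr0 ?cos0// => i _; rewrite mxE mul0r.
by apply: trig_ext (trig_lin (a - 1) c1 c1) _ => x; rewrite mulr1 subrK.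
Qed.

Lemma trigD f g : trig_closure f -> trig_closure g ->
  trig_closure (fun x => f x + g x).
Proof. by move=> tf /(trig_lin 1 tf)/trig_ext; apply=> x; rewrite mul1r. Qed.

Lemma trigZ a f : trig_closure f -> trig_closure (fun x => a * f x).
Proof. by move=> /trig_lin/(_ (trig_cst 0))/trig_ext; apply=> x; rewrite addr0. Qed.

Lemma trig_lim_bounded (F : nat -> borel_cV R n -> R) f M :
  (forall k x, `|F k x| <= M) -> (forall x, F k x @[k --> \oo] --> f x) ->
  forall x, `|f x| <= M.
Proof.
move=> FM Ff x.
have cF : `|F k x| @[k --> \oo] --> `|f x| by apply: cvg_norm; exact: Ff.
rewrite -(cvg_lim _ cF)//; apply: limr_le; first by apply/cvg_ex; exists `|f x|.
by apply: nearW => k; exact: FM.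
Qed.

Lemma trig_bounded f : trig_closure f -> exists M, forall x, `|f x| <= M.
Proof.
elim=> [u c|a {}f g _ [M fM] _ [N gN]|F {}f M _ _ FM Ff].
- by exists 1 => x; exact: cos_max.
- exists (`|a| * M + N) => x; apply: le_trans (ler_normD _ _) _.
  by rewrite lerD// normrM ler_wpM2l.
- by exists M; exact: trig_lim_bounded Ff.
Qed.

Lemma measurable_trig f : trig_closure f -> measurable_fun setT f.
Proof.
elim=> [u c|a {}f g _ mf _ mg|F {}f M _ mF _ Ff].
- apply: (measurableT_comp (f := @cos R)).
  by apply: continuous_measurable_fun; exact: continuous_cos.
  by apply: measurable_funD => //; exact: measurable_dotcV.
- by apply: measurable_funD => //; exact: measurable_funM.
- by apply: (measurable_fun_cvg (h := F)) => // x _; exact: Ff.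
Qed.

Lemma trigM f g : trig_closure f -> trig_closure g ->
  trig_closure (fun x => f x * g x).
Proof.
move=> tf tg; elim: tf => [u c|a {}f h _ tfg _ thg|F {}f M _ tFg FM Ff].
- elim: tg => [v d|a f' h _ tfg _ thg|F f' M _ tFg FM Ff].
  + apply: trig_ext (trig_lin 2^-1 (trig_cos (u + v) (c + d))
      (trigZ 2^-1 (trig_cos (u - v) (c - d)))) _ => x.
    have -> : dotcV (u + v) x + (c + d) = (dotcV u x + c) + (dotcV v x + d).
      by rewrite /dotcV linearD/= mulmxDl mxE; ring.
    have -> : dotcV (u - v) x + (c - d) = (dotcV u x + c) - (dotcV v x + d).
      by rewrite /dotcV linearB/= mulmxBl !mxE; ring.
    by rewrite cosD cosB; field.
  + by apply: trig_ext (trig_lin a tfg thg) _ => x; ring.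
  + apply: (trig_lim (M := M) tFg) => [k x|x].
      by rewrite normrM -[M]mul1r ler_pM// cos_max.
    by apply: cvgM; [exact: cvg_cst|exact: Ff].
- by apply: trig_ext (trig_lin a tfg thg) _ => x; ring.
- have [N gN] := trig_bounded tg.
  apply: (trig_lim (M := M * N) tFg) => [k x|x].
    by rewrite normrM ler_pM.
  by apply: cvgM; [exact: Ff|exact: cvg_cst].
Qed.

(** The polynomial map t |-> (3 t - t^3) / 2 sends [-1, 1] to itself, fixes
    -1, 0 and 1, and pushes every other point of [-1, 1] towards its sign: its
    iterates are a bounded sequence of polynomials converging to the sign. *)
Definition sgn_step (t : R) : R := (3 * t - t ^+ 3) / 2.

Lemma sgn_step_iter_cvg (t : R) : `|t| <= 1 ->
  iter k sgn_step t @[k --> \oo] --> Num.sg t.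
Proof.
have pos s : 0 < s <= 1 -> iter k sgn_step s @[k --> \oo] --> (1 : R).
  move=> /andP[s0 s1].
  (* Orbits increase, so they stay above s, where 1 - sgn_step r <= (1 - s / 2) (1 - r). *)
  have rge k : s <= iter k sgn_step s <= 1 /\
      1 - iter k sgn_step s <= (1 - s / 2) ^+ k.
    elim: k => [|k [/andP[+ +] +]]; first by rewrite lexx s1 expr0 /=; split => //; lra.
    rewrite iterS exprS; move: (iter k _ _) => r sr r1 rk.
    have e1 : 1 - sgn_step r = (1 - r) * ((2 - r - r ^+ 2) / 2).
      by rewrite /sgn_step; field.
    have e2 : sgn_step r - r = r * (1 - r) * (1 + r) / 2.
      by rewrite /sgn_step; field.
    have r0 : 0 < r := lt_le_trans s0 sr.
    have q0 : 0 <= (2 - r - r ^+ 2) / 2 <= 1 - s / 2 by nra.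
    have d0 : 0 <= r * (1 - r) * (1 + r) / 2.
      by rewrite divr_ge0// !mulr_ge0//; lra.
    split; first by apply/andP; split; nra.
    by rewrite e1 mulrC ler_pM//; lra.
  have qlt : `|1 - s / 2| < 1 by rewrite ltr_norml; apply/andP; split; lra.
  apply/cvgrPdist_le => e e0.
  have := cvg_expr qlt => /cvgrPdist_le/(_ _ e0); apply: filterS => k.
  rewrite sub0r normrN ger0_norm ?exprn_ge0//; last lra.
  have [/andP[_ r1] rk] := rge k.
  by move=> ke; rewrite ger0_norm ?subr_ge0// (le_trans rk).
have odd k s : iter k sgn_step (- s) = - iter k sgn_step s.
  by elim: k => //= k ->; rewrite /sgn_step; ring.
move=> t1; case: (ltgtP t 0) => t0; last first.
- rewrite t0 sgr0 (_ : (fun k => _) = fun=> 0); first exact: cvg_cst.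
  by apply/funext; elim=> //= k ->; rewrite /sgn_step expr0n/= mulr0 subr0 mul0r.
- by rewrite gtr0_sg//; apply: pos; rewrite t0 (le_trans (ler_norm _)).
- rewrite ltr0_sg// (_ : (fun k => _) = - (fun k => iter k sgn_step (- t))).
    by apply: cvgN; apply: pos; rewrite oppr_gt0 t0/= (le_trans (ler_norm _))// normrN.
  by apply/funext => k; rewrite fctE odd opprK.
Qed.

Lemma sgn_step_iter_le1 (t : R) k : `|t| <= 1 -> `|iter k sgn_step t| <= 1.
Proof.
move=> t1; elim: k => //= k; move: (iter _ _ _) => r.
rewrite !ler_norml /sgn_step => /andP[? ?].
have h1 : 0 <= (1 - r) ^+ 2 * (2 + r) by rewrite mulr_ge0 ?sqr_ge0//; lra.
have h2 : 0 <= (1 + r) ^+ 2 * (2 - r) by rewrite mulr_ge0 ?sqr_ge0//; lra.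
by apply/andP; split; lra.
Qed.

Lemma trig_sg f : trig_closure f -> trig_closure (fun x => Num.sg (f x)).
Proof.
move=> tf; have [M fM] := trig_bounded tf.
wlog : f tf M fM / M = 1.
  move=> wlg; pose c := (`|M| + 1)^-1.
  have c0 : 0 < c by rewrite invr_gt0 ltr_wpDl.
  have cf1 x : `|c * f x| <= 1.
    rewrite normrM gtr0_norm// mulrC ler_pdivrMr ?ltr_wpDl// mul1r.
    by apply: le_trans (fM x) _; rewrite (le_trans (ler_norm _)) ?lerDl.
  apply: trig_ext (wlg _ (trigZ c tf) 1 cf1 erefl) _ => x.
  by rewrite sgrM gtr0_sg// mul1r.
move=> M1; rewrite {}M1 in fM.
apply: (trig_lim (F := fun k x => iter k sgn_step (f x)) (M := 1)).
- elim=> [//|k tk] /=; apply: trig_ext (trig_lin (3 / 2) tk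
    (trigZ (- 2^-1) (trigM tk (trigM tk tk)))) _ => x.
  by rewrite /sgn_step; field.
- by move=> k x; exact: sgn_step_iter_le1.
- by move=> x; exact: sgn_step_iter_cvg.
Qed.

(** The sign of sin((<u, x> - a) / k) is eventually the sign of <u, x> - a, as
    soon as the argument has absolute value less than pi. *)
Lemma trig_half_space (u : 'cV[R]_n) a :
  trig_closure (\1_[set x | a < dotcV u x]).
Proof.
pose f x := Num.sg (dotcV u x - a) : R.
have tf : trig_closure f.
  apply: (trig_lim (M := 1)
    (F := fun k x => Num.sg (sin (k.+1%:R^-1 * (dotcV u x - a))))).
  - move=> k; apply: trig_sg.
    apply: trig_ext (trig_cos (k.+1%:R^-1 *: u) (- (k.+1%:R^-1 * a) - pi / 2)) _ => x.
    rewrite -cosBpihalf /dotcV linearZ/= -scalemxAl mxE -/(dotcV u x).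
    by congr cos; ring.
  - by move=> k x; case: sgrP; rewrite ?normr0 ?normr1 ?normrN ?normr1.
  - move=> x; rewrite /f; move: (_ - a) => y.
    apply: cvg_near_cst.
    have y0 : 0 < (`|y| + 1)^-1 * pi by rewrite mulr_gt0 ?pi_gt0// invr_gt0 ltr_wpDl.
    have pos (z : R) k : 0 < z -> k.+1%:R^-1 < (`|z| + 1)^-1 * pi ->
        0 < sin (k.+1%:R^-1 * z).
      move=> z0 kz; apply: sin_gt0_pi; rewrite mulr_gt0 ?invr_gt0//=.
      rewrite gtr0_norm// mulrC ltr_pdivlMr ?addr_gt0// in kz.
      by rewrite (le_lt_trans _ kz)// ler_wpM2l ?invr_ge0// lerDl.
    near=> k; have kz : k.+1%:R^-1 < (`|y| + 1)^-1 * pi.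
      by near: k; exact: (near_infty_natSinv_lt (PosNum y0)).
    case: (ltgtP y 0) => [yn|yp|->]; last by rewrite mulr0 sin0.
    + have := pos (- y) k; rewrite oppr_gt0 normrN mulrN sinN oppr_gt0 => /(_ yn kz) s0.
      by rewrite !ltr0_sg.
    + by rewrite !gtr0_sg// pos.
apply: trig_ext (trig_lin 2^-1 tf (trigZ 2^-1 (trigM tf tf))) _ => x.
rewrite indicE /f; case: sgrP; last 2 first.
- by rewrite subr_gt0 => ax; rewrite mem_set//= => *; field.
- rewrite subr_lt0 => ax; rewrite memNset/= ?mulr0n; first by field.
  by apply/negP; rewrite -leNgt ltW.
- move=> /eqP; rewrite subr_eq0 => /eqP <-; rewrite memNset/= ?mulr0n ?mulr0 ?addr0//.
  by rewrite ltxx.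
Unshelve. all: by end_near. Qed.

(** The sets whose indicator is in the closure form a sigma-algebra, because the
    closure is stable under products and bounded limits. *)
Lemma trig_measurable (E : set (borel_cV R n)) : measurable E -> trig_closure (\1_E).
Proof.
rewrite measurable_borel_cVE.
apply: (@smallest_sub _ (sigma_algebra setT) _ [set E | trig_closure (\1_E)]); last first.
  by move=> _ [u [a ->]]; exact: trig_half_space.
have tU A B : trig_closure (\1_A) -> trig_closure (\1_B) ->
    trig_closure (\1_(A `|` B) : borel_cV R n -> R).
  move=> tA tB; apply: trig_ext (trigD tA (trig_lin (-1) (trigM tA tB) tB)) _ => x.
  rewrite !indicE in_setU; case: (x \in A); case: (x \in B);
    rewrite /= ?mulr0n ?mulr1n; ring.
split.
- by apply: trig_ext (trig_cst 0) _ => x; rewrite indicE in_set0.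
- move=> A tA; rewrite /= setTD; apply: trig_ext (trig_lin (-1) tA (trig_cst 1)) _ => x.
  by rewrite !indicE in_setC; case: (x \in A); rewrite /= ?mulr0n ?mulr1n; ring.
- move=> A tA /=.
  apply: (trig_lim (F := fun k => \1_(\big[setU/set0]_(i < k) A i)) (M := 1)).
  + elim=> [|k tk]; first by rewrite big_ord0;
      apply: trig_ext (trig_cst 0) _ => x; rewrite indicE in_set0.
    by rewrite big_ord_recr/=; apply: tU; [exact: tk|exact: tA].
  + by move=> k x; rewrite indicE; case: (_ \in _); rewrite ?normr0 ?normr1.
  + move=> x; apply: cvg_near_cst.
    have [[i _ Aix]|nA] := pselect ((\bigcup_k A k) x).
      near=> k; have Akx : (\big[setU/set0]_(i < k) A i) x.
        by rewrite -bigcup_mkord; exists i => //=; near: k; exact: nbhs_infty_gt.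
      by rewrite !indicE !mem_set//; exists i.
    near=> k; rewrite !indicE !memNset//.
    by rewrite -bigcup_mkord => -[i _ Aix]; apply: nA; exists i.
Unshelve. all: by end_near. Qed.

Lemma integrable_bounded (P : probability (borel_cV R n) R) (f : borel_cV R n -> R) M :
  measurable_fun setT f -> (forall x, `|f x| <= M) -> P.-integrable setT (EFin \o f).
Proof.
move=> mf fM; apply: (@le_integrable _ _ _ P setT measurableT _ (cst M%:E)).
- exact/measurable_EFinP.
- by move=> x _ /=; rewrite lee_fin (le_trans (fM x)) ?ler_norm.
- exact: finite_measure_integrable_cst.
Qed.

(** Functions with the same integral under P and Q are stable under linear
    combinations and, by dominated convergence, under bounded limits; the
    cosines of affine forms are among them since they factor through a
    projection. *)
Theorem cramer_wold (P Q : probability (borel_cV R n) R) :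
  (forall (u : 'cV[R]_n) (A : set R), measurable A ->
    pushforward P (dotcV u : borel_cV R n -> R) A =
    pushforward Q (dotcV u : borel_cV R n -> R) A) ->
  forall E, measurable E -> P E = Q E.
Proof.
move=> PQ E mE.
have eqI f : trig_closure f -> (\int[P]_x (f x)%:E = \int[Q]_x (f x)%:E)%E.
  elim=> [u c|a {}f g tf If tg Ig|F {}f M tF IF FM Ff].
  - have mc : measurable_fun [set: R] (fun t : R => (cos (t + c))%:E).
      apply/measurable_EFinP; apply: measurableT_comp; last exact: measurable_funD.
      by apply: continuous_measurable_fun; exact: continuous_cos.
    pose X : {mfun borel_cV R n >-> R} := HB.pack (dotcV u : borel_cV R n -> R)
      (isMeasurableFun.Build _ _ _ _ _ (measurable_dotcV u)).
    have pf (S : probability (borel_cV R n) R) :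
        (\int[S]_x (cos (dotcV u x + c))%:E =
         \int[distribution S X]_t (cos (t + c))%:E)%E.
      rewrite integral_distribution//; apply: (@integrable_bounded S _ 1).
        exact: (measurable_trig (trig_cos u c)).
      by move=> x; exact: cos_max.
    by rewrite !pf; apply: eq_measure_integral => A mA _; exact: PQ.
  - have [M fM] := trig_bounded tf; have [N gN] := trig_bounded tg.
    have mf := measurable_trig tf; have mg := measurable_trig tg.
    have lin (S : probability (borel_cV R n) R) :
        (\int[S]_x (a * f x + g x)%:E =
         a%:E * \int[S]_x (f x)%:E + \int[S]_x (g x)%:E)%E.
      have iF := integrable_bounded S mf fM; have iG := integrable_bounded S mg gN.
      under eq_integral do rewrite EFinD EFinM.
      by rewrite integralD//= ?integralZl//; apply: integrableZl.
    by rewrite !lin If Ig.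
  - have dom (S : probability (borel_cV R n) R) :
        (\int[S]_x (F k x)%:E @[k --> \oo] --> \int[S]_x (f x)%:E)%E.
      have mF k := measurable_trig (tF k).
      have [] := @dominated_convergence _ _ _ S setT measurableT
        (fun k x => (F k x)%:E) (fun x => (f x)%:E) (cst M%:E).
      + by move=> k; exact/measurable_EFinP.
      + by apply/measurable_EFinP; exact: measurable_trig (trig_lim tF FM Ff).
      + by apply: aeW => x _; apply: cvg_EFin; [exact: nearW|exact: Ff].
      + exact: finite_measure_integrable_cst.
      + by apply: aeW => x k _; rewrite lee_fin.
      + by [].
    have e : (fun k => \int[P]_x (F k x)%:E)%E = (fun k => \int[Q]_x (F k x)%:E)%E.
      by apply/funext => k; exact: IF.
    by have := dom P; rewrite e => dP; exact: (cvg_unique _ dP (dom Q)).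
by have := eqI _ (trig_measurable mE); rewrite !integral_indic// !setIT.
Qed.

End cramer_wold.

(** * The normal law on the line *)

Definition pack_mfun d d' (T : measurableType d) (T' : measurableType d')
    (f : T -> T') (mf : measurable_fun [set: T] f) : {mfun T >-> T'} :=
  HB.pack f (isMeasurableFun.Build _ _ _ _ _ mf).

Section normal_law_theory.
Context {R : realType}.
Local Notation leb := (@lebesgue_measure R).
Implicit Types (m s v c x : R) (k : nat).

Lemma lebesgue_measure_shift c (A : set R) : measurable A ->
  leb ((fun x => x + c) @^-1` A) = leb A.
Proof.
have mc : measurable_fun [set: measurableTypeR R]
    ((fun x => x + c) : _ -> measurableTypeR R).
  exact: measurable_funD.
pose X := pack_mfun mc.
move=> mA; rewrite -[LHS]/(pushforward leb X A).
apply/esym/lebesgue_measure_unique => //= _ [[a b] _ <-].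
rewrite /pushforward/=.
rewrite (_ : _ @^-1` _ = `]a - c, b - c]%classic); last first.
  by apply/seteqP; split=> x /=; rewrite !in_itv/= ltrBlDr lerBrDr.
rewrite !lebesgue_measure_itv/= !lte_fin ltrD2r -!EFinD; congr (if _ then _%:E else _); ring.
Qed.

(** Translation fails for negative v: the standard deviation [Num.sqrt v] is
    then 0, and [normal_prob m 0] is uniform on the interval from 0 to 1. *)
Lemma normal_law_shift m v c (A : set R) : 0 <= v -> measurable A ->
  normal_law m v ((fun x => x + c) @^-1` A) = normal_law (m + c) v A.
Proof.
move=> vge0 mA; rewrite /normal_law; case: ifPn => [_|v0].
  by rewrite !diracE.
have mc : measurable_fun [set: measurableTypeR R]
    ((fun x => x + c) : _ -> measurableTypeR R).
  exact: measurable_funD.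
pose X := pack_mfun mc.
rewrite /normal_prob.
transitivity (\int[pushforward leb X]_(x in A)
    (normal_pdf (m + c) (Num.sqrt v) x)%:E)%E.
  rewrite (ge0_integral_pushforward mc).
  - apply: eq_integral => x _; congr EFin; rewrite /normal_pdf; case: ifPn => [s0|_].
    by move: s0; rewrite sqrtr_eq0 leNgt lt_neqAle eq_sym v0 vge0.
    by rewrite /normal_fun [in RHS]opprD addrACA subrr addr0.
  - exact: mA.
  - by apply/measurable_EFinP; apply: measurable_funTS; exact: measurable_normal_pdf.
  - by move=> x _; rewrite lee_fin normal_pdf_ge0.
by apply: eq_measure_integral => //= B mB _; exact: lebesgue_measure_shift.
Qed.

End normal_law_theory.

Section normal_moments.
Context {R : realType}.
Local Notation leb := (@lebesgue_measure R).
Implicit Types (m s v c x : R) (k : nat).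

Import HBNNSimple.

(** Passage from the set function, which is by definition the integral of the
    density, to integrals: simple functions, then monotone limits. *)
Lemma integral_normal_prob m s (f : R -> \bar R) :
  measurable_fun setT f -> (forall x, 0 <= f x)%E ->
  (\int[normal_prob m s]_x f x = \int[leb]_x (f x * (normal_pdf m s x)%:E))%E.
Proof.
have p0 x : (0 <= (normal_pdf m s x)%:E)%E by rewrite lee_fin normal_pdf_ge0.
have mp : measurable_fun setT (fun x => (normal_pdf m s x)%:E).
  by apply/measurable_EFinP; exact: measurable_normal_pdf.
move=> mf f0; pose f_ := nnsfun_approx measurableT mf.
have mf_ n : measurable_fun [set: R] (f_ n : R -> R) by [].
have cf x : (f_ n x)%:E @[n --> \oo] --> f x by exact: cvg_nnsfun_approx.
have nd x : {homo (fun n => (f_ n x)%:E) : n p / (n <= p)%N >-> (n <= p)%E}.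
  by move=> n p np; rewrite lee_fin; exact/lefP/nd_nnsfun_approx.
transitivity (limn (fun n => \int[normal_prob m s]_x (f_ n x)%:E))%E.
  rewrite -monotone_convergence//=.
  - by apply: eq_integral => x _; apply/esym/cvg_lim => //; exact: cf.
  - by move=> n; apply/measurable_EFinP; exact: mf_.
  - by move=> n x _; rewrite lee_fin.
rewrite (_ : (fun n => _) =
    (fun n => \int[leb]_x ((f_ n x)%:E * (normal_pdf m s x)%:E)))%E; last first.
  apply/funext => n.
  have mE r : measurable (f_ n @^-1` [set r]) by rewrite -[X in measurable X]setTI; exact: mf_.
  have m1 r : measurable_fun [set: R] (\1_(f_ n @^-1` [set r]) : R -> R).
    exact: measurable_indic.
  under [LHS]eq_integral do rewrite fimfunE -fsumEFin//.
  under [RHS]eq_integral.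
    move=> x _; rewrite fimfunE -fsumEFin// ge0_mule_fsuml; last first.
      by move=> r; rewrite EFinM nnfun_muleindic_ge0.
    over.
  rewrite ge0_integral_fsum//; last 2 first.
  - by move=> r; apply/measurable_EFinP; apply: measurable_funM;
      [exact: measurable_cst|exact: m1].
  - by move=> r x _; rewrite EFinM nnfun_muleindic_ge0.
  rewrite ge0_integral_fsum//; last 2 first.
  - move=> r; apply: emeasurable_funM => //; apply/measurable_EFinP.
    by apply: measurable_funM; [exact: measurable_cst|exact: m1].
  - by move=> r x _; rewrite mule_ge0// EFinM nnfun_muleindic_ge0.
  apply: eq_fsbigr => r _; have [r0|r0] := ltP r 0.
    by rewrite preimage_nnfun0//; under eq_integral do rewrite indic0 mulr0;
      under [RHS]eq_integral do rewrite indic0 mulr0 mul0e; rewrite !integral0.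
  under [LHS]eq_integral do rewrite EFinM.
  rewrite ge0_integralZl_EFin//; last first.
    by apply/measurable_EFinP; exact: m1.
  rewrite integral_indic//; last exact: mE.
  rewrite setIT.
  under [RHS]eq_integral do rewrite EFinM -muleA.
  rewrite ge0_integralZl_EFin//; last 2 first.
  - by move=> x _; rewrite mule_ge0// lee_fin.
  - by apply: emeasurable_funM => //; by apply/measurable_EFinP; exact: m1.
  congr (_ * _)%E; rewrite /normal_prob [LHS]integral_mkcond.
  by apply: eq_integral => x _; rewrite epatch_indic muleC.
rewrite -monotone_convergence//=.
- apply: eq_integral => x _; apply/cvg_lim => //.
  by apply: cvgeZr => //; exact: cf.
- by move=> n; apply: emeasurable_funM => //; apply/measurable_EFinP; exact: mf_.
- by move=> n x _; rewrite mule_ge0// lee_fin.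
- by move=> x _ n p np; rewrite lee_wpmul2r//; exact: nd.
Qed.

Lemma normal_pdf0E s x : s != 0 ->
  normal_pdf 0 s x = normal_peak s * expR (- x ^+ 2 / (s ^+ 2 *+ 2)).
Proof. by move=> s0; rewrite /normal_pdf (negbTE s0)/= /normal_fun subr0. Qed.

(** Serves both to make boundary terms vanish at infinity and to restore the
    sign of an integrand in [half_momentS2]. *)
Lemma normal_pdf_expR_bound s k : s != 0 ->
  exists2 C : R, 0 <= C &
  forall x, 0 <= x -> x ^+ k * normal_pdf 0 s x <= C * expR (- x).
Proof.
move=> s0; have s2 : 0 < s ^+ 2 by rewrite exprn_even_gt0.
(* x^k <= k! e^x, and 2 x - x^2 / (2 s^2) <= 2 s^2 by completing the square. *)
exists (k`!%:R * normal_peak s * expR (2 * s ^+ 2)).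
  by rewrite !mulr_ge0 ?normal_peak_ge0 ?expR_ge0.
move=> x x0; rewrite normal_pdf0E// mulrCA -[leRHS]mulrA [k`!%:R * _]mulrC -mulrA.
rewrite ler_wpM2l ?normal_peak_ge0//.
have xk : x ^+ k <= k`!%:R * expR x.
  case: k => [|k]; first by rewrite expr0 fact0 mul1r -expR0 ler_expR.
  rewrite mulrC -ler_pdivrMr ?ltr0n ?fact_gt0//.
  by apply: le_trans (expR_ge1Dxn k x0); rewrite lerDr.
apply: (@le_trans _ _ (k`!%:R * expR x * expR (- x ^+ 2 / (s ^+ 2 *+ 2)))).
  by rewrite ler_wpM2r ?expR_ge0.
rewrite -!mulrA ler_wpM2l// -!expRD ler_expR -subr_ge0.
rewrite (_ : _ - _ = (x - 2 * s ^+ 2) ^+ 2 / (s ^+ 2 *+ 2)); last by field.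
by rewrite divr_ge0// ?sqr_ge0// mulrn_wge0// ltW.
Qed.

Definition half_moment s k : \bar R :=
  (\int[leb]_(x in `[0%R, +oo[) (x ^+ k * normal_pdf 0 s x)%:E)%E.

(** Integration by parts: - s^2 x^(k+1) p(x) is an antiderivative of
    x^(k+2) p(x) - s^2 (k+1) x^k p(x), where p is the density. This integrand
    changes sign, whereas the fundamental theorem of calculus on a half-line
    wants a nonnegative one; adding the multiple e of exp(- x) makes it so, and
    the integral of e is then cancelled. *)
Lemma half_momentS2 s k : s != 0 ->
  (half_moment s k.+2 = (s ^+ 2 * k.+1%:R)%:E * half_moment s k)%E.
Proof.
move=> s0; have s2 : 0 < s ^+ 2 by rewrite exprn_even_gt0.
pose p x := normal_pdf 0 s x.
have p0 x : 0 <= p x := normal_pdf_ge0 0 s x.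
have cp : continuous p := continuous_normal_pdf s0 (m := 0).
have dp x : is_derive x 1 p (- (x / s ^+ 2) * p x).
  have pE : p = normal_peak s \*: (expR \o ((- (s ^+ 2 *+ 2)^-1) \*: (@id R ^+ 2))).
    apply/funext => y; rewrite /p normal_pdf0E//=; congr (_ * expR _).
    by rewrite /GRing.scale/= mulNr mulrC mulNr.
  rewrite [X in is_derive _ _ X _]pE; apply: is_derive_eq.
  rewrite /p normal_pdf0E//= /GRing.scale/= !fctE.
  have -> : - (s ^+ 2 *+ 2)^-1 * x ^+ 2 = - x ^+ 2 / (s ^+ 2 *+ 2).
    by rewrite mulNr mulrC mulNr.
  by move: (expR _) => E; field.
have [C C0 pC] := normal_pdf_expR_bound k s0.
have [C' C'0 pC'] := normal_pdf_expR_bound k.+1 s0.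
pose b := s ^+ 2 * k.+1%:R.
have b0 : 0 <= b by rewrite mulr_ge0// ltW.
pose e x := b * C * expR (- x).
have e0 x : 0 <= e x by apply: mulr_ge0; [exact: mulr_ge0|exact: expR_ge0].
have de x : is_derive x 1 (- e) (e x).
  have -> : - e = - ((b * C) \*: (expR \o -%R)) by [].
  by apply: is_derive_eq; rewrite /e /GRing.scale/= mulrN1 mulrN opprK.
have ce : continuous e.
  move=> x; apply: cvgM; first exact: cvg_cst.
  by apply: (cvg_comp (@GRing.opp R) expR); [exact: opp_continuous|exact: continuous_expR].
have cq q : continuous (fun x => x ^+ q * p x).
  by move=> x; apply: cvgM; [exact: exprn_continuous|exact: cp].
pose F x := - (s ^+ 2 * (x ^+ k.+1 * p x)) - e x.
pose f x := x ^+ k.+2 * p x - b * (x ^+ k * p x) + e x.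
have cf : continuous f.
  move=> x; apply: cvgD; last exact: ce.
  by apply: cvgB; [exact: cq|apply: cvgM; [exact: cvg_cst|exact: cq]].
have f0 x : 0 <= x -> 0 <= f x.
  move=> x0; have -> : f x = x ^+ k.+2 * p x + b * (C * expR (- x) - x ^+ k * p x).
    by rewrite /f /e; ring.
  apply: addr_ge0; apply: mulr_ge0 => //; first exact: exprn_ge0.
  by rewrite subr_ge0; exact: pC.
have dF x : is_derive x 1 F (f x).
  have -> : F = - (s ^+ 2 \*: ((@id R ^+ k.+1) * p)) - (b * C) \*: (expR \o -%R).
    by apply/funext => y; rewrite /F /e !fctE.
  apply: is_derive_eq; rewrite /f /e /b /GRing.scale/= !fctE/=.
  by rewrite [x ^+ k.+2]exprS [x ^+ k.+1]exprS; field.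
have cF : continuous F by move=> x; apply: differentiable_continuous; exact/derivable1_diffP.
have cvge : e x @[x --> +oo] --> 0.
  by rewrite -[0](mulr0 (b * C)); apply: cvgM; [exact: cvg_cst|exact: cvgr_expR].
have cvgp : x ^+ k.+1 * p x @[x --> +oo] --> 0.
  apply: (@squeeze_cvgr _ _ _ _ (cst 0) (fun x => C' * expR (- x))).
  - near=> x; have x0 : 0 <= x by near: x; exact: nbhs_pinfty_ge.
    by rewrite mulr_ge0 ?exprn_ge0//= pC'.
  - exact: cvg_cst.
  - by rewrite -[0](mulr0 C'); apply: cvgM; [exact: cvg_cst|exact: cvgr_expR].
have If : (\int[leb]_(x in `[0%R, +oo[) (f x)%:E = (b * C)%:E)%E.
  rewrite (@ge0_continuous_FTC2y _ f F 0 0)//.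
  - by rewrite -EFinB /F /e expr0n/= oppr0 expR0; congr EFin; ring.
  - exact: continuous_subspaceT.
  - rewrite -[0]subr0; apply: cvgB => //; rewrite -[0]oppr0; apply: cvgN.
    by rewrite -[0](mulr0 (s ^+ 2)); apply: cvgM; [exact: cvg_cst|exact: cvgp].
  - by apply: cvg_at_right_filter; exact: cF.
  - by move=> x _; rewrite derive1E; apply: derive_val.
have Ie : (\int[leb]_(x in `[0%R, +oo[) (e x)%:E = (b * C)%:E)%E.
  rewrite (@ge0_continuous_FTC2y _ e (- e) 0 0)//.
  - by rewrite -EFinB opprfctE /e oppr0 expR0; congr EFin; ring.
  - exact: continuous_subspaceT.
  - by rewrite -[0]oppr0; apply: cvgN.
  - by apply: cvgN; apply: cvg_at_right_filter; exact: ce.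
  - by move=> x _; rewrite derive1E; apply: derive_val.
have mq q : measurable_fun (`[0%R, +oo[ : set R) (fun x : R => (x ^+ q * p x)%:E).
  by apply/measurable_EFinP; apply: measurable_funTS; apply: continuous_measurable_fun; exact: cq.
have me : measurable_fun (`[0%R, +oo[ : set R) (EFin \o e).
  by apply/measurable_EFinP; apply: measurable_funTS; exact: continuous_measurable_fun.
have q0 q x : [set` `[0%R, +oo[%R] x -> (0 <= (x ^+ q * p x)%:E)%E.
  by rewrite /= in_itv/= andbT => x0; rewrite lee_fin mulr_ge0 ?exprn_ge0.
have mI : measurable ([set` `[0%R, +oo[%R] : set R) by exact: measurable_itv.
have L : (\int[leb]_(x in `[0%R, +oo[) ((x ^+ k.+2 * p x)%:E + (e x)%:E) =
    half_moment s k.+2 + (b * C)%:E)%E.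
  rewrite ge0_integralD//; [by rewrite Ie|exact: q0|exact: mq|].
  by move=> x _; rewrite lee_fin.
have r : (\int[leb]_(x in `[0%R, +oo[) ((f x)%:E + b%:E * (x ^+ k * p x)%:E) =
    (b * C)%:E + b%:E * half_moment s k)%E.
  rewrite ge0_integralD//.
  - by rewrite If ge0_integralZl_EFin//; [exact: q0|exact: mq].
  - by move=> x; rewrite /= in_itv/= andbT => x0; rewrite lee_fin f0.
  - by apply/measurable_EFinP; apply: measurable_funTS; exact: continuous_measurable_fun.
  - by move=> x /(q0 k) x0; rewrite mule_ge0.
  - by apply: measurable_funeM; exact: mq.
suff e2 : (half_moment s k.+2 + (b * C)%:E = b%:E * half_moment s k + (b * C)%:E)%E.
  by rewrite -[LHS](@addeK _ (b * C)%:E)// e2 addeK.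
rewrite [RHS]addeC -L -r.
by apply: eq_integral => x _; rewrite -!EFinM -!EFinD /f; congr EFin; ring.
Unshelve. all: by end_near. Qed.

Lemma normal_prob_even_moment s k : s != 0 -> ~~ odd k ->
  (\int[normal_prob 0%R s]_x (x ^+ k)%:E = 2%:E * half_moment s k)%E.
Proof.
move=> s0 ek; rewrite integral_normal_prob; last 2 first.
- by apply/measurable_EFinP; apply: continuous_measurable_fun; exact: exprn_continuous.
- by move=> x; rewrite lee_fin exprn_even_ge0.
rewrite ge0_symfun_integralT//.
- by rewrite -set_itvcy.
- by move=> x; rewrite mulr_ge0 ?normal_pdf_ge0// exprn_even_ge0.
- by move=> x; apply: cvgM; [exact: exprn_continuous|exact: continuous_normal_pdf].
- by move=> x; rewrite /= !normal_pdf0E// exprNn -signr_odd (negbTE ek) mul1r sqrrN.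
Qed.

(** The mean of f under [normal_law 0 v], by cases as in [normal_law] because
    the latter carries no measure structure to integrate against. *)
Definition normal_mean v (f : R -> \bar R) : \bar R :=
  if v == 0 then f 0 else (\int[normal_prob 0%R (Num.sqrt v)]_x f x)%E.

Lemma normal_moment2 s : s != 0 ->
  (\int[normal_prob 0%R s]_x (x ^+ 2)%:E = (s ^+ 2)%:E)%E.
Proof.
move=> s0; rewrite normal_prob_even_moment// half_momentS2// mulr1.
rewrite muleCA -normal_prob_even_moment//.
by under eq_integral do rewrite expr0; rewrite integral_cst//= probability_setT !mule1.
Qed.

Lemma normal_moment4 s : s != 0 ->
  (\int[normal_prob 0%R s]_x (x ^+ 4)%:E = (3 * s ^+ 4)%:E)%E.
Proof.
move=> s0; rewrite normal_prob_even_moment// half_momentS2//.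
rewrite muleCA -normal_prob_even_moment// normal_moment2// -EFinM; congr EFin; ring.
Qed.

Lemma normal_mean_sqr v : 0 <= v -> normal_mean v (fun x => (x ^+ 2)%:E) = v%:E.
Proof.
rewrite /normal_mean; case: eqP => [->|/eqP v0 vge0]; first by rewrite expr0n.
by rewrite normal_moment2 ?sqr_sqrtr// sqrtr_eq0 -ltNge lt_neqAle eq_sym v0.
Qed.

Lemma normal_mean_pow4 v : 0 <= v ->
  normal_mean v (fun x => (x ^+ 4)%:E) = (3 * v ^+ 2)%:E.
Proof.
rewrite /normal_mean; case: eqP => [->|/eqP v0 vge0]; first by rewrite !expr0n mulr0.
rewrite normal_moment4 ?(exprM _ 2 2) ?sqr_sqrtr//.
by rewrite sqrtr_eq0 -ltNge lt_neqAle eq_sym v0.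
Qed.

End normal_moments.

(** * Moments of Gaussian measures on R^n *)

Section gaussian_moments.
Context {R : realType} {n : nat}.
Implicit Types (a u x : 'cV[R]_n) (S : 'M[R]_n) (P : probability (borel_cV R n) R).

Lemma dotcVD u1 u2 x : dotcV (u1 + u2) x = dotcV u1 x + dotcV u2 x.
Proof. by rewrite /dotcV linearD/= mulmxDl mxE. Qed.

Lemma dotcVN u x : dotcV (- u) x = - dotcV u x.
Proof. by rewrite /dotcV linearN/= mulNmx mxE. Qed.

Lemma dotcVDr u x1 x2 : dotcV u (x1 + x2) = dotcV u x1 + dotcV u x2.
Proof. by rewrite /dotcV mulmxDr mxE. Qed.

Lemma dotcVNr u x : dotcV u (- x) = - dotcV u x.
Proof. by rewrite /dotcV mulmxN mxE. Qed.

Lemma gaussian_projection a S P u (f : R -> \bar R) :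
  gaussian_with a S P -> measurable_fun setT f -> (forall t, 0 <= f t)%E ->
  (\int[P]_x f (dotcV u x - dotcV u a)%R = normal_mean (dotcV u (S *m u)) f)%E.
Proof.
move=> [[_ psdS] Pu] mf f0; set v := dotcV u (S *m u).
have v0 : 0 <= v by exact: psdS.
have mX : measurable_fun [set: borel_cV R n]
    (fun x => dotcV u x - dotcV u a : measurableTypeR R).
  by apply: measurable_funB => //; exact: measurable_dotcV.
have mf' : measurable_fun [set: measurableTypeR R] f := mf.
rewrite -(ge0_integral_distribution (pack_mfun mX))//.
have law A : measurable A -> distribution P (pack_mfun mX) A = normal_law 0 v A.
  move=> mA; rewrite -[0](subrr (dotcV u a)) -normal_law_shift// -Pu//.
  by rewrite -[X in measurable X]setTI; apply: measurable_funD.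
rewrite /normal_mean; case: ifPn => [v_0|v_neq0].
  rewrite (eq_measure_integral \d_(0 : measurableTypeR R)) => [|A mA _].
    by rewrite integral_dirac// diracT mul1e.
  by apply: (etrans (law A mA)); rewrite /normal_law v_0.
apply: eq_measure_integral => A mA _.
by apply: (etrans (law A mA)); rewrite /normal_law (negbTE v_neq0).
Qed.

(** With even powers and nonnegative coefficients every integrand is nonnegative
    and no integrability condition arises. *)
Lemma gaussian_even_quartic a S P u (b c d : R) : gaussian_with a S P ->
  0 <= b -> 0 <= c -> 0 <= d ->
  let v := dotcV u (S *m u) in
  (\int[P]_x (b * (dotcV u x - dotcV u a) ^+ 4
     + c * (dotcV u x - dotcV u a) ^+ 2 + d)%:E = (3 * b * v ^+ 2 + c * v + d)%:E)%E.
Proof.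
move=> gP b0 c0 d0 v.
have v0 : 0 <= v by case: gP => -[_ psdS] _; exact: psdS.
have mX : measurable_fun [set: borel_cV R n] (fun x => dotcV u x - dotcV u a : R).
  by apply: measurable_funB => //; exact: measurable_dotcV.
have mXk (k : nat) : measurable_fun [set: borel_cV R n]
    (fun x => ((dotcV u x - dotcV u a : R) ^+ k)%:E).
  by apply/measurable_EFinP; exact: measurable_funX.
have mk (k : nat) : measurable_fun [set: R] (fun t : R => (t ^+ k)%:E).
  by apply/measurable_EFinP; exact: exprn_measurable.
have Xk_ge0 x (k : nat) : ~~ odd k -> (0 <= ((dotcV u x - dotcV u a) ^+ k)%:E)%E.
  by move=> ek; rewrite lee_fin exprn_even_ge0.
have e4 : (\int[P]_x ((dotcV u x - dotcV u a) ^+ 4)%:E = (3 * v ^+ 2)%:E)%E.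
  rewrite (@gaussian_projection a S P u (fun t => (t ^+ 4)%:E))//.
    exact: normal_mean_pow4.
  by move=> t; rewrite lee_fin exprn_even_ge0.
have e2 : (\int[P]_x ((dotcV u x - dotcV u a) ^+ 2)%:E = v%:E)%E.
  rewrite (@gaussian_projection a S P u (fun t => (t ^+ 2)%:E))//.
    exact: normal_mean_sqr.
  by move=> t; rewrite lee_fin sqr_ge0.
under eq_integral do rewrite 2!EFinD (EFinM b) (EFinM c).
rewrite ge0_integralD//; last 2 first.
- by move=> x _; rewrite adde_ge0// mule_ge0// Xk_ge0.
- by apply: emeasurable_funD; apply: measurable_funeM.
rewrite ge0_integralD//; last 4 first.
- by move=> x _; rewrite mule_ge0// Xk_ge0.
- exact: measurable_funeM.
- by move=> x _; rewrite mule_ge0// Xk_ge0.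
- exact: measurable_funeM.
rewrite !ge0_integralZl_EFin//; last 2 first.
- by move=> x _; rewrite Xk_ge0.
- by move=> x _; rewrite Xk_ge0.
rewrite e4 e2 integral_cst//= probability_setT mule1 -!EFinM -!EFinD; congr EFin; ring.
Qed.

(** The centred projection on u has the same law as its opposite, which is the
    centred projection on - u. So the mean of (t - Y)^4 is also that of
    (t + Y)^4, and in the sum of the two the odd powers of Y cancel. *)
Lemma gaussian_sub_pow4 a S P u (t : R) : gaussian_with a S P ->
  let v := dotcV u (S *m u) in
  (\int[P]_x ((t - (dotcV u x - dotcV u a)) ^+ 4)%:E =
   (t ^+ 4 + 6 * t ^+ 2 * v + 3 * v ^+ 2)%:E)%E.
Proof.
move=> gP v.
have mX w : measurable_fun [set: borel_cV R n] (fun x => dotcV w x - dotcV w a : R).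
  by apply: measurable_funB => //; exact: measurable_dotcV.
have mXt w : measurable_fun [set: borel_cV R n]
    (fun x => ((t - (dotcV w x - dotcV w a) : R) ^+ 4)%:E).
  by apply/measurable_EFinP; apply: measurable_funX; exact: measurable_funB.
have mt : measurable_fun [set: R] (fun r : R => ((t - r) ^+ 4)%:E).
  by apply/measurable_EFinP; apply: measurable_funX; exact: measurable_funB.
have X0 w x : (0 <= ((t - (dotcV w x - dotcV w a)) ^+ 4)%:E)%E.
  by rewrite lee_fin exprn_even_ge0.
pose I w := (\int[P]_x ((t - (dotcV w x - dotcV w a)) ^+ 4)%:E)%E.
have sym : I (- u) = I u.
  have p w : I w = normal_mean (dotcV w (S *m w)) (fun r => ((t - r) ^+ 4)%:E).
    rewrite /I (@gaussian_projection a S P w (fun r => ((t - r) ^+ 4)%:E))//.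
    by move=> r; rewrite lee_fin exprn_even_ge0.
  by rewrite !p dotcVN mulmxN dotcVNr opprK.
have : (I u + I (- u)%R =
    (3 * 2 * v ^+ 2 + 12 * t ^+ 2 * v + 2 * t ^+ 4)%:E)%E.
  rewrite -(gaussian_even_quartic u gP)//; last 2 first.
  - by rewrite mulr_ge0// sqr_ge0.
  - by rewrite mulr_ge0// exprn_even_ge0.
  rewrite /I -ge0_integralD//; apply: eq_integral => x _.
  by rewrite -EFinD !dotcVN; congr EFin; ring.
rewrite sym -/(I u).
case: (I u) => [r| |]//; rewrite -EFinD => -[rr]; congr EFin.
apply: (@mulfI _ 2); first by [].
by rewrite mulr_natl mulr2n rr; ring.
Qed.

(** 12 v^2 is the fourth moment 3 (2 v)^2 of a difference of independent
    centred Gaussian variables of variance v. *)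
Lemma gaussian_pair_pow4 a S P u : gaussian_with a S P ->
  (\int[P \x P]_z ((dotcV u (z.1 - z.2)) ^+ 4)%:E =
   (12 * dotcV u (S *m u) ^+ 2)%:E)%E.
Proof.
move=> gP; set v := dotcV u (S *m u).
have v0 : 0 <= v by case: gP => -[_ psdS] _; exact: psdS.
have mfst : measurable_fun [set: borel_cV R n * borel_cV R n] (fun z => dotcV u z.1 : R).
  by apply: (measurableT_comp (measurable_dotcV u)).
have msnd : measurable_fun [set: borel_cV R n * borel_cV R n] (fun z => dotcV u z.2 : R).
  by apply: (measurableT_comp (measurable_dotcV u)).
under eq_integral do rewrite dotcVDr dotcVNr.
rewrite fubini_tonelli1/=; last 2 first.
- apply/measurable_EFinP; apply: measurable_funX; exact: measurable_funB.
- by move=> z; rewrite lee_fin exprn_even_ge0.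
transitivity (\int[P]_x (1 * (dotcV u x - dotcV u a) ^+ 4 +
    (6 * v) * (dotcV u x - dotcV u a) ^+ 2 + 3 * v ^+ 2)%:E)%E; last first.
  rewrite (gaussian_even_quartic u gP)//; last 2 first.
  - by rewrite mulr_ge0.
  - by rewrite mulr_ge0// sqr_ge0.
  by congr EFin; rewrite -/v; ring.
apply: eq_integral => x _; rewrite /fubini_F/=.
transitivity (\int[P]_y ((dotcV u x - dotcV u a - (dotcV u y - dotcV u a)) ^+ 4)%:E)%E.
  by apply: eq_integral => y _; congr EFin; ring.
rewrite (gaussian_sub_pow4 u _ gP); congr EFin; rewrite -/v; ring.
Qed.

End gaussian_moments.

(** * The mean fourth power of the distance between two points *)

Section distances.
Context {R : realType} {n : nat}.
Implicit Types (a u x : 'cV[R]_n) (S : 'M[R]_n) (P : probability (borel_cV R n) R).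

Lemma enorm_sqr x : enorm x ^+ 2 = \sum_i x i 0 ^+ 2.
Proof.
have e : dotcV x x = \sum_i x i 0 ^+ 2.
  by rewrite dotcVE; apply: eq_bigr => i _; rewrite expr2.
by rewrite /enorm e sqr_sqrtr// sumr_ge0// => i _; rewrite sqr_ge0.
Qed.

Lemma frobenius_sqr p q (A : 'M[R]_(p, q)) :
  frobenius A ^+ 2 = \sum_i \sum_j A i j ^+ 2.
Proof.
by rewrite sqr_sqrtr// sumr_ge0// => i _; rewrite sumr_ge0// => j _; rewrite sqr_ge0.
Qed.

Lemma measurable_coord_sub (i : 'I_n) :
  measurable_fun [set: borel_cV R n * borel_cV R n] (fun z => z.1 i 0 - z.2 i 0 : R).
Proof.
apply: measurable_funB.
  exact: (measurableT_comp (measurable_coord i) measurable_fst).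
exact: (measurableT_comp (measurable_coord i) measurable_snd).
Qed.

Lemma measurable_enorm_sub_sqr :
  measurable_fun [set: borel_cV R n * borel_cV R n]
    (fun z => enorm (z.1 - z.2 : 'cV[R]_n) ^+ 2).
Proof.
rewrite (_ : (fun z => _) = fun z : borel_cV R n * borel_cV R n =>
    \sum_i (z.1 i 0 - z.2 i 0) ^+ 2).
  by apply: measurable_sum => i; apply: measurable_funX; exact: measurable_coord_sub.
by apply/funext => z; rewrite enorm_sqr; apply: eq_bigr => i _; rewrite !mxE.
Qed.

Lemma dotcV_delta_mul S (i j : 'I_n) :
  dotcV (delta_mx i 0) (S *m delta_mx j 0) = S i j.
Proof. by rewrite dotcV_delta -colE mxE. Qed.

(** Polarization: 12 p^2 q^2 + 2 p^4 + 2 q^4 = (p + q)^4 + (p - q)^4, where the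
    fourth powers are those of the linear forms e_i, e_j, e_i + e_j, e_i - e_j. *)
Lemma gaussian_pair_sqr_sqr a S P (i j : 'I_n) : gaussian_with a S P ->
  (\int[P \x P]_z ((z.1 i 0 - z.2 i 0) ^+ 2 * (z.1 j 0 - z.2 j 0) ^+ 2)%:E =
   (4 * S i i * S j j + 8 * S i j ^+ 2)%:E)%E.
Proof.
move=> gP; have [[trS _] _] := gP.
have Sji : S j i = S i j by rewrite -[in LHS]trS mxE.
pose Z k (z : borel_cV R n * borel_cV R n) : R := z.1 k 0 - z.2 k 0.
have mZ k : measurable_fun setT (Z k) by exact: measurable_coord_sub.
have ZE k z : dotcV (delta_mx k 0) (z.1 - z.2) = Z k z by rewrite dotcV_delta !mxE.
have I4 k : (\int[P \x P]_z (Z k z ^+ 4)%:E = (12 * S k k ^+ 2)%:E)%E.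
  under eq_integral do rewrite -ZE.
  by rewrite (gaussian_pair_pow4 _ gP) dotcV_delta_mul.
have Ip : (\int[P \x P]_z ((Z i z + Z j z) ^+ 4)%:E =
    (12 * (S i i + S j j + 2 * S i j) ^+ 2)%:E)%E.
  under eq_integral do rewrite -!ZE -dotcVD.
  rewrite (gaussian_pair_pow4 _ gP) dotcVD mulmxDr !dotcVDr !dotcV_delta_mul Sji.
  by congr EFin; ring.
have Im : (\int[P \x P]_z ((Z i z - Z j z) ^+ 4)%:E =
    (12 * (S i i + S j j - 2 * S i j) ^+ 2)%:E)%E.
  under eq_integral do rewrite -!ZE -dotcVN -dotcVD.
  rewrite (gaussian_pair_pow4 _ gP) dotcVD mulmxDr !dotcVDr.
  rewrite mulmxN !dotcVN !dotcVNr !dotcV_delta_mul Sji.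
  by congr EFin; ring.
have m4 k : measurable_fun setT (fun z => (Z k z ^+ 4)%:E).
  by apply/measurable_EFinP; exact: measurable_funX.
have mp : measurable_fun setT (fun z => ((Z i z + Z j z) ^+ 4)%:E).
  by apply/measurable_EFinP; apply: measurable_funX; exact: measurable_funD.
have mm : measurable_fun setT (fun z => ((Z i z - Z j z) ^+ 4)%:E).
  by apply/measurable_EFinP; apply: measurable_funX; exact: measurable_funB.
have m22 : measurable_fun setT (fun z => (Z i z ^+ 2 * Z j z ^+ 2)%:E).
  by apply/measurable_EFinP; apply: measurable_funM; exact: measurable_funX.
have p4 t : (0 <= (t ^+ 4)%:E :> \bar R)%E by rewrite lee_fin exprn_even_ge0.
have p22 z : (0 <= (Z i z ^+ 2 * Z j z ^+ 2)%:E)%E.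
  by rewrite lee_fin mulr_ge0// sqr_ge0.
rewrite -[LHS]/(\int[P \x P]_z (Z i z ^+ 2 * Z j z ^+ 2)%:E)%E.
have : (12%:E * \int[P \x P]_z (Z i z ^+ 2 * Z j z ^+ 2)%:E
    + (2%:E * \int[P \x P]_z (Z i z ^+ 4)%:E + 2%:E * \int[P \x P]_z (Z j z ^+ 4)%:E) =
    \int[P \x P]_z ((Z i z + Z j z) ^+ 4)%:E +
    \int[P \x P]_z ((Z i z - Z j z) ^+ 4)%:E)%E.
  rewrite -!ge0_integralZl_EFin//.
  rewrite -!ge0_integralD//; last 8 first.
  all: try by move=> z _; rewrite ?adde_ge0 ?mule_ge0.
  all: try by do ?apply: emeasurable_funD; apply: measurable_funeM.
  apply: eq_integral => z _; rewrite -!EFinM -!EFinD; congr EFin; ring.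
rewrite !I4 Ip Im.
case: (\int[P \x P]_z (Z i z ^+ 2 * Z j z ^+ 2)%:E)%E => [r| |]; last 2 first.
(* An infinite mean would contradict the finite right-hand side. *)
- by rewrite mulry gtr0_sg// mul1e.
- by rewrite mulrNy gtr0_sg// mul1e.
rewrite -!EFinM -!EFinD => -[rr]; congr EFin.
by apply: (@mulfI _ 12) => //; lra.
Qed.

Definition quartic_spread P : \bar R :=
  (\int[P \x P]_z ((enorm (z.1 - z.2 : 'cV[R]_n) ^+ 2) ^+ 2)%:E)%E.

Lemma gaussian_quartic_spread a S P : gaussian_with a S P ->
  quartic_spread P = (4 * (\tr S) ^+ 2 + 8 * frobenius S ^+ 2)%:E.
Proof.
move=> gP.
pose Z k (z : borel_cV R n * borel_cV R n) : R := z.1 k 0 - z.2 k 0.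
transitivity (\int[P \x P]_z (\sum_i \sum_j (Z i z ^+ 2 * Z j z ^+ 2)%:E))%E.
  apply: eq_integral => z _; rewrite enorm_sqr expr2 big_distrlr/=.
  rewrite -sumEFin; apply: eq_bigr => i _; rewrite -sumEFin; apply: eq_bigr => j _.
  by rewrite !mxE.
have m22 i j : measurable_fun setT (fun z => (Z i z ^+ 2 * Z j z ^+ 2)%:E).
  apply/measurable_EFinP; apply: measurable_funM; apply: measurable_funX;
  exact: measurable_coord_sub.
have p22 i j z : (0 <= (Z i z ^+ 2 * Z j z ^+ 2)%:E)%E.
  by rewrite lee_fin mulr_ge0// sqr_ge0.
rewrite ge0_integral_sum//; last 2 first.
- by move=> i; exact: emeasurable_sum.
- by move=> i z _; exact: sume_ge0.
under eq_bigr => i _.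
  rewrite ge0_integral_sum//.
  under eq_bigr do rewrite (gaussian_pair_sqr_sqr _ _ gP).
  rewrite sumEFin; over.
rewrite sumEFin; congr EFin; rewrite frobenius_sqr expr2 /mxtrace big_distrlr/=.
rewrite !mulr_sumr -big_split/=; apply: eq_bigr => i _.
by rewrite !mulr_sumr -big_split/=; apply: eq_bigr => j _; rewrite mulrA.
Qed.

End distances.

(** * The lower bound on the cost of a coupling *)

Section transport_cost.
Context {R : realType}.

Lemma integral_prod_pushforward d d' (T : measurableType d) (T' : measurableType d')
    (P : probability T R) (Q : probability T' R) (phi : T -> T')
    (g : T' * T' -> \bar R) :
  measurable_fun setT phi ->
  (forall A, measurable A -> pushforward P phi A = Q A) ->
  measurable_fun setT g -> (forall z, 0 <= g z)%E ->
  (\int[P \x P]_z g (phi z.1, phi z.2) = \int[Q \x Q]_z g z)%E.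
Proof.
move=> mphi PQ mg g0.
have one h : measurable_fun setT h -> (forall y, 0 <= h y)%E ->
    (\int[P]_x h (phi x) = \int[Q]_y h y)%E.
  move=> mh h0; rewrite -(ge0_integral_distribution (pack_mfun mphi))//.
  by apply: eq_measure_integral => A mA _; exact: PQ.
have mgphi : measurable_fun setT (fun z : T * T => g (phi z.1, phi z.2)).
  apply: (measurableT_comp mg); apply/measurable_fun_pairP; split.
    exact: (measurableT_comp mphi measurable_fst).
  exact: (measurableT_comp mphi measurable_snd).
rewrite !fubini_tonelli1//.
rewrite -one; last 2 first.
- exact: measurable_fun_fubini_tonelli_F.
- by move=> y; exact: integral_ge0.
apply: eq_integral => x _; rewrite /fubini_F/=.
apply: (one (fun y => g (phi x, y))) => //.
by apply: (measurableT_comp mg); exact: measurable_pair1.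
Qed.

Context {m n : nat}.
Implicit Types (mu : probability (borel_cV R m) R) (nu : probability (borel_cV R n) R)
  (pi : probability (borel_cV R m * borel_cV R n)%type R).

Let T := (borel_cV R m * borel_cV R n)%type.
Let dX (z : T * T) : R := enorm (z.1.1 - z.2.1 : 'cV[R]_m) ^+ 2.
Let dY (z : T * T) : R := enorm (z.1.2 - z.2.2 : 'cV[R]_n) ^+ 2.

Let measurable_dX : measurable_fun setT dX.
Proof.
apply: (measurableT_comp (f := fun z : borel_cV R m * borel_cV R m =>
  enorm (z.1 - z.2 : 'cV[R]_m) ^+ 2) (g := fun z : T * T => (z.1.1, z.2.1))).
  exact: measurable_enorm_sub_sqr.
apply/measurable_fun_pairP; split => /=.
  exact: (measurableT_comp measurable_fst measurable_fst).
exact: (measurableT_comp measurable_fst measurable_snd).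
Qed.

Let measurable_dY : measurable_fun setT dY.
Proof.
apply: (measurableT_comp (f := fun z : borel_cV R n * borel_cV R n =>
  enorm (z.1 - z.2 : 'cV[R]_n) ^+ 2) (g := fun z : T * T => (z.1.2, z.2.2))).
  exact: measurable_enorm_sub_sqr.
apply/measurable_fun_pairP; split => /=.
  exact: (measurableT_comp measurable_snd measurable_fst).
exact: (measurableT_comp measurable_snd measurable_snd).
Qed.

Lemma measurable_distortion :
  measurable_fun setT (fun z : T * T => ((dX z - dY z) ^+ 2)%:E).
Proof. by apply/measurable_EFinP; apply: measurable_funX; exact: measurable_funB. Qed.

Lemma gw_cost_prod pi :
  gw_cost pi = (\int[pi \x pi]_z ((dX z - dY z) ^+ 2)%:E)%E.
Proof.
rewrite fubini_tonelli1//; first exact: measurable_distortion.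
by move=> z; rewrite lee_fin sqr_ge0.
Qed.

(** The reverse triangle inequality in L^2, proved without norms: integrate
    Young's inequality 2 X Y <= t X^2 + Y^2 / t. The best t is lambda; taking it
    slightly larger covers lambda = 0, at the price of an arbitrarily small
    error. *)
Lemma gw_cost_ge mu nu pi (K lambda : R) : coupling mu nu pi ->
  0 <= lambda -> quartic_spread mu = K%:E -> quartic_spread nu = (lambda ^+ 2 * K)%:E ->
  (((lambda - 1) ^+ 2 * K)%:E <= gw_cost pi)%E.
Proof.
move=> [pimu pinu] l0 muK nuK.
have mX2 : measurable_fun setT (fun z => (dX z ^+ 2)%:E).
  by apply/measurable_EFinP; exact: measurable_funX.
have mY2 : measurable_fun setT (fun z => (dY z ^+ 2)%:E).
  by apply/measurable_EFinP; exact: measurable_funX.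
have m2 k : measurable_fun setT (fun z : borel_cV R k * borel_cV R k =>
    ((enorm (z.1 - z.2 : 'cV[R]_k) ^+ 2) ^+ 2)%:E).
  by apply/measurable_EFinP; apply: measurable_funX; exact: measurable_enorm_sub_sqr.
have p2 k (z : borel_cV R k * borel_cV R k) :
    (0 <= ((enorm (z.1 - z.2 : 'cV[R]_k) ^+ 2) ^+ 2)%:E)%E.
  by rewrite lee_fin sqr_ge0.
have IX : (\int[pi \x pi]_z (dX z ^+ 2)%:E = K%:E)%E.
  by rewrite -muK /quartic_spread -(integral_prod_pushforward measurable_fst pimu (m2 m) (p2 m)).
have IY : (\int[pi \x pi]_z (dY z ^+ 2)%:E = (lambda ^+ 2 * K)%:E)%E.
  by rewrite -nuK /quartic_spread -(integral_prod_pushforward measurable_snd pinu (m2 n) (p2 n)).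
have X0 z : (0 <= (dX z ^+ 2)%:E)%E by rewrite lee_fin sqr_ge0.
have Y0 z : (0 <= (dY z ^+ 2)%:E)%E by rewrite lee_fin sqr_ge0.
have D0 z : (0 <= ((dX z - dY z) ^+ 2)%:E)%E by rewrite lee_fin sqr_ge0.
have K0 : 0 <= K by rewrite -lee_fin -IX integral_ge0.
have young t : 0 < t ->
   (K%:E + (lambda ^+ 2 * K)%:E <=
    gw_cost pi + (t%:E * K%:E + t^-1%:E * (lambda ^+ 2 * K)%:E))%E.
  move=> t0; have ti0 : 0 <= t^-1 by rewrite invr_ge0 ltW.
  have t0' := ltW t0; have mD := measurable_distortion.
  rewrite -IX -IY gw_cost_prod -!ge0_integralZl_EFin//.
  have mtX : measurable_fun setT (fun z => (t%:E * (dX z ^+ 2)%:E)%E).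
    exact: measurable_funeM.
  have mtY : measurable_fun setT (fun z => (t^-1%:E * (dY z ^+ 2)%:E)%E).
    exact: measurable_funeM.
  have ptX z : (0 <= t%:E * (dX z ^+ 2)%:E)%E by rewrite mule_ge0.
  have ptY z : (0 <= t^-1%:E * (dY z ^+ 2)%:E)%E by rewrite mule_ge0.
  rewrite -!ge0_integralD//; last 2 first.
  - by move=> z _; rewrite adde_ge0.
  - exact: emeasurable_funD.
  apply: ge0_le_integral => //.
  - by move=> z _; rewrite adde_ge0.
  - exact: emeasurable_funD.
  - by apply: emeasurable_funD => //; exact: emeasurable_funD.
  - move=> z _; rewrite -!EFinM -!EFinD lee_fin -subr_ge0.
    rewrite (_ : _ - _ = t^-1 * (t * dX z - dY z) ^+ 2).
      by rewrite mulr_ge0// sqr_ge0.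
    by field; rewrite gt_eqF.
case: (gw_cost pi) young => [r| |] young; last 2 first.
- by rewrite leey.
- by have := young 1 ltr01.
rewrite lee_fin; apply/ler_addgt0Pr => e e0.
pose d := e / (K + 1).
have K1 : 0 < K + 1 by rewrite ltr_wpDl.
have d0 : 0 < d by rewrite divr_gt0.
have dK : d * K <= e.
  by rewrite /d mulrAC ler_pdivrMr// ler_wpM2l ?ltW// ltrDl.
have td : 0 < lambda + d by rewrite ltr_wpDl.
have := young (lambda + d) td; rewrite -!EFinM -!EFinD lee_fin => yg.
have lt : (lambda + d)^-1 * (lambda ^+ 2 * K) <= lambda * K.
  by rewrite mulrA ler_wpM2r// mulrC ler_pdivrMr// expr2 ler_wpM2l// lerDl ltW.
nra.
Qed.

End transport_cost.

(** * Affine images of Gaussian measures *)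

Section gaussian_affine.
Context {R : realType}.

Lemma dotcV_mulmx p q (u : 'cV[R]_p) (L : 'M[R]_(p, q)) (x : 'cV[R]_q) :
  dotcV u (L *m x) = dotcV (L^T *m u) x.
Proof. by rewrite /dotcV trmx_mul trmxK mulmxA. Qed.

Lemma measurable_affine p q (L : 'M[R]_(q, p)) (b : 'cV[R]_q) :
  measurable_fun [set: borel_cV R p] (fun x : borel_cV R p => L *m x + b : borel_cV R q).
Proof.
apply: measurable_fun_borel_cV => u.
under eq_fun do rewrite dotcVDr dotcV_mulmx.
by apply: measurable_funD => //; exact: measurable_dotcV.
Qed.

Lemma gaussian_affine p q (P : probability (borel_cV R p) R) a S
    (L : 'M[R]_(q, p)) (b : 'cV[R]_q) :
  gaussian_with a S P ->
  gaussian_with (L *m a + b) (L *m S *m L^T)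
    (pushforward P (fun x : borel_cV R p => L *m x + b : borel_cV R q)).
Proof.
move=> [[trS psdS] Pu]; have var u : dotcV u (L *m S *m L^T *m u) =
    dotcV (L^T *m u) (S *m (L^T *m u)) by rewrite -!mulmxA dotcV_mulmx.
split; first split.
- by rewrite !trmx_mul trmxK trS mulmxA.
- by move=> u; rewrite var; exact: psdS.
move=> u A mA; rewrite dotcVDr dotcV_mulmx var -normal_law_shift ?psdS// -Pu.
  rewrite /pushforward; congr (P _); apply/seteqP.
  by split=> x /=; rewrite dotcVDr dotcV_mulmx.
by rewrite -[X in measurable X]setTI; apply: measurable_funD.
Qed.

Lemma gaussian_unique n (P Q : probability (borel_cV R n) R) a S :
  gaussian_with a S P -> gaussian_with a S Q -> forall E, measurable E -> P E = Q E.
Proof.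
move=> [_ Pu] [_ Qu] E mE.
by apply: cramer_wold => // u A mA; rewrite Pu// Qu.
Qed.

End gaussian_affine.

(** * Orthogonal changes of basis *)

Section orthogonal_invariance.
Context {R : realType} {n : nat}.
Implicit Types (P D A : 'M[R]_n).

Lemma orthogonal_mxC P : orthogonal_mx P -> P^T *m P = 1%:M.
Proof. exact: mulmx1C. Qed.

Lemma frobenius_sqr_trace A : frobenius A ^+ 2 = \tr (A *m A^T).
Proof.
rewrite frobenius_sqr; apply: eq_bigr => i _; rewrite mxE.
by apply: eq_bigr => j _; rewrite mxE expr2.
Qed.

Lemma frobenius_sqrZ (l : R) A : frobenius (l *: A) ^+ 2 = l ^+ 2 * frobenius A ^+ 2.
Proof.
rewrite !frobenius_sqr_trace linearZ/= -scalemxAl -scalemxAr !mxtraceZ.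
by rewrite mulrA expr2.
Qed.

Lemma frobeniusZ (l : R) A : 0 <= l -> frobenius (l *: A) = l * frobenius A.
Proof.
move=> l0; apply/eqP; rewrite -(@eqrXn2 _ 2)// ?mulr_ge0 ?sqrtr_ge0//.
by rewrite frobenius_sqrZ exprMn.
Qed.

Lemma mxtrace_orthogonal_conj P D : orthogonal_mx P -> \tr (P *m D *m P^T) = \tr D.
Proof. by move=> /orthogonal_mxC oP; rewrite mxtrace_mulC mulmxA oP mul1mx. Qed.

Lemma frobenius_orthogonal_conj P D : orthogonal_mx P ->
  frobenius (P *m D *m P^T) = frobenius D.
Proof.
move=> oP; apply/eqP; rewrite -(@eqrXn2 _ 2)// ?sqrtr_ge0// !frobenius_sqr_trace.
rewrite !trmx_mul trmxK -(mxtrace_orthogonal_conj (D *m D^T) oP) !mulmxA.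
by rewrite -(mulmxA (P *m D)) orthogonal_mxC// mulmx1.
Qed.

Definition sign_row (eps : 'rV[R]_n) : Prop := forall i, eps 0 i = 1 \/ eps 0 i = -1.

Lemma sign_diag_mxK (eps : 'rV[R]_n) : sign_row eps ->
  diag_mx eps *m diag_mx eps = 1%:M.
Proof.
move=> e1; rewrite mulmx_diag -diag_const_mx; congr diag_mx.
by apply/rowP => i; rewrite !mxE; case: (e1 i) => ->; rewrite ?mulrNN mulr1.
Qed.

Lemma sign_alignment_isometry P0 P1 (eps : 'rV[R]_n) : orthogonal_mx P0 ->
  orthogonal_mx P1 -> sign_row eps ->
  let Q := P1 *m diag_mx eps *m P0^T in Q^T *m Q = 1%:M.
Proof.
move=> oP0 /orthogonal_mxC oP1 /sign_diag_mxK ee /=.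
rewrite !trmx_mul trmxK tr_diag_mx !mulmxA -(mulmxA _ P1^T) oP1 mulmx1.
by rewrite -(mulmxA P0) ee mulmx1 oP0.
Qed.

(** A sign matrix commutes with the diagonal matrix D and squares to 1. *)
Lemma sign_alignment_conj P0 P1 D (eps : 'rV[R]_n) : orthogonal_mx P0 ->
  is_diag_mx D -> sign_row eps ->
  let Q := P1 *m diag_mx eps *m P0^T in
  Q *m (P0 *m D *m P0^T) *m Q^T = P1 *m D *m P1^T.
Proof.
move=> /orthogonal_mxC oP0 /diag_mxP[d ->] /sign_diag_mxK ee /=.
rewrite !trmx_mul trmxK tr_diag_mx !mulmxA -(mulmxA _ P0^T) oP0 mulmx1.
rewrite -(mulmxA _ P0^T) oP0 mulmx1 -(mulmxA P1 (diag_mx eps)).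
by rewrite diag_mxC mulmxA -(mulmxA _ (diag_mx eps) (diag_mx eps)) ee mulmx1.
Qed.

Lemma enorm_sqr_dotcV (x : 'cV[R]_n) : enorm x ^+ 2 = dotcV x x.
Proof. by rewrite enorm_sqr dotcVE; apply: eq_bigr => i _; rewrite expr2. Qed.

End orthogonal_invariance.

(** * The coupling carried by the graph of an affine map *)

Section affine_coupling.
Context {R : realType} {n : nat}.
Variables (mu nu : probability (borel_cV R n) R).
Variables (m0 m1 : 'cV[R]_n) (S0 S1 : 'M[R]_n) (L : 'M[R]_n).
Hypotheses (mu_gauss : gaussian_with m0 S0 mu) (nu_gauss : gaussian_with m1 S1 nu).
Hypothesis S1E : S1 = L *m S0 *m L^T.

Let F (x : borel_cV R n) : borel_cV R n := L *m x + (m1 - L *m m0).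
Let G (x : borel_cV R n) : borel_cV R n * borel_cV R n := (x, F x).

Let measurable_F : measurable_fun setT F.
Proof. exact: measurable_affine. Qed.

Let measurable_G : measurable_fun setT G.
Proof. by apply/measurable_fun_pairP; split => //=; exact: measurable_id. Qed.

Definition affine_coupling : probability (borel_cV R n * borel_cV R n)%type R :=
  distribution mu (pack_mfun measurable_G).

Lemma affine_couplingE A : affine_coupling A = pushforward mu G A.
Proof. by []. Qed.

Lemma affine_coupling_coupling : coupling mu nu affine_coupling.
Proof.
have gF : gaussian_with m1 S1 (distribution mu (pack_mfun measurable_F)).
  have := gaussian_affine L (m1 - L *m m0) mu_gauss.
  by rewrite -S1E addrC subrK.
split=> [//|B mB].
transitivity (distribution mu (pack_mfun measurable_F) B); first by [].
exact: (gaussian_unique gF nu_gauss).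
Qed.

Lemma affine_coupling_gaussian : gaussian_pair affine_coupling.
Proof.
have := gaussian_affine (col_mx 1%:M L) (col_mx 0 (m1 - L *m m0)) mu_gauss.
set g := (X in pushforward mu X).
have -> : g = (fun p : borel_cV R n * borel_cV R n =>
    col_mx p.1 p.2 : borel_cV R (n + n)) \o G.
  by apply/funext => x; rewrite /g mul_col_mx mul1mx add_col_mx addr0.
by move=> gG; do 2 eexists; exact: gG.
Qed.

(** When L / sqrt lambda is an isometry, the two squared distances in the cost
    differ by the factor lambda. *)
Lemma affine_coupling_cost (lambda : R) : 0 <= lambda -> L^T *m L = lambda%:M ->
  gw_cost affine_coupling =
  ((lambda - 1) ^+ 2 * (4 * (\tr S0) ^+ 2 + 8 * frobenius S0 ^+ 2))%:E.
Proof.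
move=> l0 LL; rewrite gw_cost_prod.
have mD := @measurable_distortion R n n.
rewrite -(@integral_prod_pushforward _ _ _ _ _ mu affine_coupling G _ _ _ mD)//; last first.
  by move=> z; rewrite lee_fin sqr_ge0.
rewrite [RHS]EFinM -(gaussian_quartic_spread mu_gauss).
rewrite /quartic_spread -ge0_integralZl_EFin//; last 3 first.
- by move=> z _; rewrite lee_fin sqr_ge0.
- by apply/measurable_EFinP; apply: measurable_funX; exact: measurable_enorm_sub_sqr.
- by rewrite sqr_ge0.
apply: eq_integral => -[x y] _ /=; rewrite -EFinM; congr EFin.
have -> : F x - F y = L *m (x - y).
  by rewrite /F mulmxBr opprD addrACA subrr addr0.
rewrite [enorm (L *m _) ^+ 2]enorm_sqr_dotcV dotcV_mulmx mulmxA LL mul_scalar_mx.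
rewrite /dotcV linearZ/= -scalemxAl mxE -/(dotcV _ _) -enorm_sqr_dotcV; ring.
Qed.

End affine_coupling.

(** * Equality of the three distances *)

Theorem proposition5p2 (R : realType) (m : nat)
    (mu nu : probability (borel_cV R m) R)
    (m0 m1 : 'cV[R]_m) (S0 S1 P0 P1 D0 D1 : 'M[R]_m) (lambda : R)
    (mu_gauss : gaussian_with m0 S0 mu) (nu_gauss : gaussian_with m1 S1 nu)
    (diagS0 : sorted_diagonalization S0 P0 D0)
    (diagS1 : sorted_diagonalization S1 P1 D1)
    (S0_nonsingular : S0 \in unitmx)
    (lambda_ge0 : 0 <= lambda) (D1E : D1 = lambda *: D0) :
  [/\ GW2sq mu nu = GGW2sq mu nu,
      GGW2sq mu nu = (LGW2sq (leqnn m) D0 D1)%:E,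
      forall eps : 'rV[R]_m, (forall i, eps 0 i = 1 \/ eps 0 i = -1) ->
        let T (x : 'cV[R]_m) : 'cV[R]_m :=
          m1 + Num.sqrt lambda *: (P1 *m diag_mx eps *m P0^T *m (x - m0)) in
        exists pi : probability (borel_cV R m * borel_cV R m)%type R,
          GW_solution mu nu pi /\
          (forall A, measurable A ->
             pi A = pushforward mu
               (fun x : borel_cV R m =>
                  (x, T x) : borel_cV R m * borel_cV R m) A)
    & GW2sq mu nu =
        ((lambda - 1) ^+ 2 * (4 * (\tr S0) ^+ 2 + 8 * frobenius S0 ^+ 2))%:E].
Proof.
have [oP0 _ S0E] := diagS0; have [oP1 _ S1E] := diagS1.
have [tr0 fr0] : \tr S0 = \tr D0 /\ frobenius S0 = frobenius D0.
  by rewrite S0E mxtrace_orthogonal_conj// frobenius_orthogonal_conj.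
have [tr1 fr1] : \tr S1 = lambda * \tr D0 /\ frobenius S1 = lambda * frobenius D0.
  rewrite S1E mxtrace_orthogonal_conj// frobenius_orthogonal_conj//.
  by rewrite D1E mxtraceZ frobeniusZ.
set K := 4 * (\tr S0) ^+ 2 + 8 * frobenius S0 ^+ 2.
set c := ((lambda - 1) ^+ 2 * K)%:E.
have lower pi : coupling mu nu pi -> (c <= gw_cost pi)%E.
  have muK : quartic_spread mu = K%:E := gaussian_quartic_spread mu_gauss.
  have nuK : quartic_spread nu = (lambda ^+ 2 * K)%:E.
    rewrite (gaussian_quartic_spread nu_gauss) /K tr1 fr1 tr0 fr0.
    by congr EFin; ring.
  by move=> cpi; exact: (gw_cost_ge cpi lambda_ge0 muK nuK).
pose L (eps : 'rV[R]_m) : 'M[R]_m := Num.sqrt lambda *: (P1 *m diag_mx eps *m P0^T).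
have dD0 : is_diag_mx D0 by case: diagS0 => _ [].
have LS eps : sign_row eps -> S1 = L eps *m S0 *m (L eps)^T.
  move=> se; rewrite /L linearZ/= -!scalemxAl -scalemxAr scalerA -expr2 sqr_sqrtr//.
  by rewrite S0E sign_alignment_conj// S1E D1E -scalemxAr -scalemxAl.
have LL eps : sign_row eps -> (L eps)^T *m L eps = lambda%:M.
  move=> se; rewrite /L -scalemxAr linearZ/= -scalemxAl scalerA -expr2 sqr_sqrtr//.
  by rewrite sign_alignment_isometry// scalemx1.
pose pi eps := affine_coupling mu m0 m1 (L eps).
have cpi eps : sign_row eps -> coupling mu nu (pi eps).
  by move=> se; apply: (affine_coupling_coupling mu_gauss nu_gauss); exact: LS.
have costpi eps : sign_row eps -> gw_cost (pi eps) = c.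
  by move=> se; apply: (affine_coupling_cost m1 mu_gauss lambda_ge0); exact: LL.
have s1 : sign_row (const_mx 1 : 'rV[R]_m) by move=> i; left; rewrite mxE.
have GWc : GW2sq mu nu = c.
  apply/eqP; rewrite eq_le; apply/andP; split.
    by apply: ereal_inf_lbound; exists (pi (const_mx 1)); [exact: cpi|exact: costpi].
  by apply: le_ereal_inf_tmp => _ [p cp <-]; exact: lower.
have GGWc : GGW2sq mu nu = c.
  apply/eqP; rewrite eq_le; apply/andP; split.
    apply: ereal_inf_lbound; exists (pi (const_mx 1)); last exact: costpi.
    split; [exact: cpi|exact: (affine_coupling_gaussian m1 _ mu_gauss)].
  by apply: le_ereal_inf_tmp => _ [p [cp _] <-]; exact: lower.
split.
- by rewrite GWc GGWc.
- have D0E : leading_submx (leqnn m) D0 = D0.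
    by apply/matrixP => i j; rewrite mxE; congr (D0 _ _); exact: val_inj.
  have D01 : D0 - lambda *: D0 = (1 - lambda) *: D0 by rewrite scalerBl scale1r.
  rewrite GGWc /LGW2sq D0E D1E D01 mxtraceZ frobenius_sqrZ frobeniusZ//.
  by rewrite /c /K tr0 fr0; congr EFin; ring.
- move=> eps e1 T; exists (pi eps); split.
    by split; [exact: cpi|rewrite GWc; exact: costpi].
  move=> A _; rewrite affine_couplingE; congr (pushforward mu _ A).
  apply/funext => x; congr pair; rewrite /T /L mulmxBr -!scalemxAl scalerBr.
  by rewrite addrCA.
- exact: GWc.
Qed.
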